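(* Let $n\ge2$ and let $Q_z$ be the linear operator on $\mathbb{C}[x_1,\ldots,x_n]^{S_n}$ defined by $Q_z\bar E_\lambda=q_\lambda(z)\bar E_\lambda$, $q_\lambda(z)=\bar E_\lambda(z,1,\ldots,1)$, for all partitions $\lambda$ of length $n$. Let $\mathcal P:\mathbb{C}[x_1,\ldots,x_n]^{S_n}\to\mathbb{C}[x_1,\ldots,x_{n-1}]^{S_{n-1}}$ be given by $(\mathcal Pf)(x_1,\ldots,x_{n-1})=f(x_1,\ldots,x_{n-1},0)$. Then the operator $Q_0$ (that is, $Q_z$ taken at $z=0$) admits a unique factorization $Q_0=Q_0'\mathcal P$ with a linear operator $Q_0':\mathbb{C}[x_1,\ldots,x_{n-1}]^{S_{n-1}}\to\mathbb{C}[x_1,\ldots,x_n]^{S_n}$, and for every partition $(\lambda_1,\ldots,\lambda_{n-1})$ of length $n-1$, $$Q_0':\ \bar E_{(\lambda_1,\ldots,\lambda_{n-1})}(x_1,\ldots,x_{n-1})\mapsto\bar E_{(\lambda_1,\ldots,\lambda_{n-1},0)}(x_1,\ldots,x_n).$$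
   Context: Partitions of length $N$ are $\lambda=(\lambda_1,\ldots,\lambda_N)\in\mathbb{N}^N$ with $\lambda_1\ge\cdots\ge\lambda_N\ge0$; put $\lambda_{N+1}=0$. For such $\lambda$, $\bar E_\lambda(x_1,\ldots,x_N)=\prod_{j=1}^N\bar e_j(x)^{\lambda_j-\lambda_{j+1}}$, where $\bar e_j(x)=e_j(x)/e_j(1,\ldots,1)=e_j(x)/\binom Nj$ and $e_j$ is the $j$-th elementary symmetric function of $x_1,\ldots,x_N$. The $\bar E_\lambda$ form a basis of the space $\mathbb{C}[x_1,\ldots,x_N]^{S_N}$ of symmetric polynomials. *)

(* Defs.v *)
From HB Require Import structures.
From mathcomp Require Import all_boot all_order all_algebra all_fingroup.
From mathcomp Require Export mpoly.

Set Implicit Arguments.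
Unset Strict Implicit.
Unset Printing Implicit Defensive.

Import GRing.Theory.
Local Open Scope ring_scope.

(* The space F[x_1, ..., x_n]^{S_n}. *)
Record sympoly (n : nat) (F : fieldType) := SymPoly {
  mpoly_of_sympoly :> {mpoly F[n]};
  _ : mpoly_of_sympoly \is symmetric }.

HB.instance Definition _ n F := [isSub for @mpoly_of_sympoly n F].
HB.instance Definition _ n F := [Choice of sympoly n F by <:].
HB.instance Definition _ n F := [SubChoice_isSubLmodule of sympoly n F by <:].

Definition is_partition (N : nat) (l : seq nat) : bool :=
  (size l == N) && sorted geq l.

Definition ebar (N : nat) (F : fieldType) (j : nat) : {mpoly F[N]} :=
  ('C(N, j)%:R)^-1 *: mesym N F j.

(* Entries of l are numbered from 0; the default value of nth provides
   lambda_(N+1) = 0 when size l = N. *)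
Definition Ebar_poly (N : nat) (F : fieldType) (l : seq nat) : {mpoly F[N]} :=
  \prod_(j < N) ebar N F j.+1 ^+ (nth 0 l j - nth 0 l j.+1)%N.

Lemma Ebar_sym (N : nat) (F : fieldType) (l : seq nat) :
  Ebar_poly N F l \is symmetric.
Proof. by apply: rpred_prod => j _; apply/rpredX/rpredZ/mesym_sym. Qed.

Definition Ebar (N : nat) (F : fieldType) (l : seq nat) : sympoly N F :=
  SymPoly (Ebar_sym N F l).

Definition qeig (N : nat) (F : fieldType) (l : seq nat) (z : F) : F :=
  (Ebar_poly N F l).@[fun i : 'I_N => if val i == 0%N then z else 1].

(* insub sends i : 'I_n to the same index in 'I_n.-1 when i < n.-1, and to
   None when i is the last index. *)
Definition set_last0 (n : nat) (F : fieldType) (f : {mpoly F[n]}) :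
    {mpoly F[n.-1]} :=
  f \mPo [tuple (if insub (val i) is Some j then 'X_j else 0) | i < n].

Lemma set_last0_sym (n : nat) (F : fieldType) (f : sympoly n F) :
  set_last0 f \is symmetric.
Proof.
case: f => f /= fs; apply: msym_comp_poly => // s; apply/tuple_permP.
case: n f fs s => [|n] f _ s.
  by exists 1%g; apply: (@eq_from_nth _ 0); rewrite !size_tuple.
exists (lift_perm ord_max ord_max s^-1)%g; apply: (@eq_from_nth _ 0).
  by rewrite !size_tuple.
move=> k; rewrite size_tuple => ltk.
pose i := Ordinal ltk; rewrite -[k]/(nat_of_ord i).
rewrite -!tnth_nth !tnth_mktuple -tnth_nth tnth_mktuple.
have [j|] := unliftP ord_max i => ->.
  rewrite lift_perm_lift ![val _]lift_max !valK msymX.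
  by congr 'X_[_]; apply/mnmP => k'; rewrite !mnmE (inj_eq perm_inj).
by rewrite lift_perm_id /= insubN ?ltnn // msym0.
Qed.

Definition restr0 (n : nat) (F : fieldType) (f : sympoly n F) :
  sympoly n.-1 F := SymPoly (set_last0_sym f).

(* Q_z exists: since q_lambda(z) is multiplicative in the e_j, it is the algebra
   morphism scaling each e_j by its eigenvalue. *)
Lemma Q_exists (n : nat) (F : fieldType) (z : F) :
  exists Q : {linear sympoly n F -> sympoly n F},
    forall l : seq nat, is_partition n l ->
      Q (Ebar n F l) = qeig n l z *: Ebar n F l.
Proof.
pose S := [tuple mesym n F i.+1 | i < n].
pose c (i : 'I_n) : F :=
  (ebar n F i.+1).@[fun i : 'I_n => if val i == 0%N then z else 1].
pose T := [tuple c i *: mesym n F i.+1 | i < n].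
have Ts (f : sympoly n F) : symf (val f) \mPo T \is symmetric.
  apply: mcomp_sym => i; rewrite -tnth_nth tnth_mktuple.
  exact/rpredZ/mesym_sym.
pose q f := SymPoly (Ts f).
have qlin : linear q.
  move=> a f g; apply: val_inj => /=.
  rewrite -comp_mpolyZ -comp_mpolyD; congr (_ \mPo T).
  apply: msym_fundamental_un.
  rewrite comp_mpolyD comp_mpolyZ -!symfP ?(valP f) ?(valP g) //.
  exact: (valP (a *: f + g)).
pose HL := GRing.isLinear.Build F (sympoly n F) (sympoly n F) *:%R q qlin.
pose Q : {linear sympoly n F -> sympoly n F} := HB.pack q HL.
exists Q => l _; apply: val_inj => /=.
pose t : {mpoly F[n]} := \prod_(j < n)
  (('C(n, j.+1)%:R)^-1 *: 'X_j) ^+ (nth 0 l j - nth 0 l j.+1)%N.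
have comp_t (U : n.-tuple {mpoly F[n]}) : t \mPo U =
    \prod_(j < n) (('C(n, j.+1)%:R)^-1 *: tnth U j)
       ^+ (nth 0 l j - nth 0 l j.+1)%N.
  rewrite rmorph_prod; apply: eq_bigr => j _.
  by rewrite rmorphXn /= comp_mpolyZ comp_mpolyXU -tnth_nth.
have -> : symf (Ebar_poly n F l) = t.
  apply: msym_fundamental_un; rewrite -symfP ?Ebar_sym // comp_t.
  by apply: eq_bigr => j _; rewrite tnth_mktuple.
rewrite comp_t /qeig rmorph_prod /=.
rewrite (eq_bigr (fun j : 'I_n => c j ^+ (nth 0 l j - nth 0 l j.+1)%N *:
  ebar n F j.+1 ^+ (nth 0 l j - nth 0 l j.+1)%N)).
  rewrite scaler_prod; congr (_ *: _).
  by apply: eq_bigr => j _; rewrite rmorphXn.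
move=> j _; rewrite tnth_mktuple -exprZn /ebar.
by rewrite !scalerA mulrC.
Qed.

(* Main.v *)
(* Each ebar_j(x_1, ..., x_(n-1), 0) is the scalar c_j = ebar_j(0, 1, ..., 1)
   times the ebar_j in n - 1 variables, and c_j <> 0 exactly when j < n. Hence P
   maps Ebar_lambda to q_lambda(0) Ebar_(lambda_1, ..., lambda_(n-1)), both
   sides vanishing when lambda_n > 0. The linear map sending each
   Ebar_(lambda_1, ..., lambda_(n-1)) to Ebar_(lambda_1, ..., lambda_(n-1), 0)
   therefore factors Q_0, and it is unique because P hits a nonzero multiple of
   every Ebar. *)
Require Import Defs.
From HB Require Import structures.
From mathcomp Require Import all_boot all_order all_algebra.
From mathcomp Require Import all_fingroup.
From mathcomp Require Import reals complex.
Import GRing.Theory.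
Local Open Scope ring_scope.

Section Span.
Context (n : nat) (F : numFieldType).

Lemma bin_natr_neq0 (m k : nat) : (k <= m)%N -> 'C(m, k)%:R != 0 :> F.
Proof. by rewrite Num.Theory.pnatr_eq0 -lt0n bin_gt0. Qed.

(** Suffix sums invert the passage to consecutive differences, so [Ebar] of this partition is the
    monomial in the [ebar] with exponent vector [m]. *)
Definition partition_of_mnm (m : 'X_{1..n}) : seq nat :=
  mkseq (fun j => \sum_(i < n | (j <= i)%N) m i)%N n.

Lemma nth_partition_of_mnm (m : 'X_{1..n}) (j : nat) :
  nth 0%N (partition_of_mnm m) j = (\sum_(i < n | (j <= i)%N) m i)%N.
Proof.
have [ltjn|lenj] := ltnP j n; first exact: nth_mkseq.
rewrite nth_default ?size_mkseq // big_pred0 // => i.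
by rewrite leqNgt (leq_trans (ltn_ord i) lenj).
Qed.

Lemma nth_partition_of_mnmD (m : 'X_{1..n}) (j : 'I_n) :
  nth 0%N (partition_of_mnm m) j =
  (m j + nth 0%N (partition_of_mnm m) j.+1)%N.
Proof.
rewrite !nth_partition_of_mnm (bigD1 j) //=; congr addn.
by apply: eq_bigl => i; rewrite ltn_neqAle andbC eq_sym.
Qed.

Lemma is_partition_of_mnm (m : 'X_{1..n}) : is_partition n (partition_of_mnm m).
Proof.
rewrite /is_partition size_mkseq eqxx; apply/(sortedP 0%N) => i.
rewrite size_mkseq => /ltnW ltin.
by have /= -> := nth_partition_of_mnmD m (Ordinal ltin); apply: leq_addl.
Qed.

(** By the fundamental theorem [f] is the polynomial [symf f] in the e_j, and each monomial in the
    e_j is a scalar multiple of one [Ebar]. *)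
Lemma Ebar_span (f : sympoly n F) :
  exists c : 'X_{1..n} -> F,
    f = \sum_(m <- msupp (symf f)) c m *: Ebar n F (partition_of_mnm m).
Proof.
(* The binomials undo the normalization of each [ebar]. *)
exists (fun m => (symf f)@_m * \prod_(i < n) 'C(n, i.+1)%:R ^+ m i).
apply: val_inj; rewrite linear_sum /= [LHS]symfP ?(valP f) //.
rewrite comp_mpolyEX; apply: eq_bigr => m _.
rewrite -scalerA; congr (_ *: _); rewrite comp_mpolyX -scaler_prod.
apply: eq_bigr => i _.
rewrite tnth_mktuple nth_partition_of_mnmD addnK -exprZn /ebar scalerA divff.
  by rewrite scale1r.
exact: bin_natr_neq0.
Qed.

Lemma eq_linear_Ebar (V : lmodType F) (f g : {linear sympoly n F -> V}) :
  (forall l, is_partition n l -> f (Ebar n F l) = g (Ebar n F l)) -> f =1 g.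
Proof.
move=> efg p; have [c ->] := Ebar_span p; rewrite !linear_sum /=.
by apply: eq_bigr => m _; rewrite !linearZ_LR efg // is_partition_of_mnm.
Qed.

End Span.

Section RestrictionLinear.
Context (n : nat) (F : numFieldType).

Lemma set_last0_is_linear : linear (@set_last0 n F).
Proof. by move=> a f g; rewrite /set_last0 comp_mpolyD comp_mpolyZ. Qed.

Lemma restr0_is_linear : linear (@restr0 n F).
Proof. by move=> a f g; apply: val_inj; apply: set_last0_is_linear. Qed.

HB.instance Definition _ :=
  GRing.isLinear.Build F (sympoly n F) (sympoly n.-1 F) _ (@restr0 n F)
    restr0_is_linear.

End RestrictionLinear.

Section MesymRestriction.
Context (n : nat) (F : numFieldType).

Lemma set_last0_mwiden (p : {mpoly F[n]}) : set_last0 (mwiden p) = p.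
Proof.
elim/mpolyind: p => [|c m p _ _ IHp].
  by rewrite mwiden0 /set_last0 raddf0.
rewrite mwidenD mwidenZ mwidenX set_last0_is_linear IHp; congr (_ *: _ + _).
rewrite /set_last0 comp_mpolyX big_ord_recr /= mnmwiden_ordmax expr0 mulr1.
rewrite mpolyXE_id; apply: eq_bigr => i _.
by rewrite mnmwiden_widen tnth_mktuple /= valK.
Qed.

(** In e_(k+1)(x_1, ..., x_(n+1)) = e_(k+1)(x_1, ..., x_n) + e_k(x_1, ..., x_n) x_(n+1) the last
    term vanishes at x_(n+1) = 0. *)
Lemma set_last0_mesym (k : nat) :
  set_last0 (mesym n.+1 F k) = mesym n F k.
Proof.
case: k => [|k]; first by rewrite !mesym0E /set_last0 rmorph1.
rewrite mesymSS /set_last0 rmorphD rmorphM /= comp_mpolyXU.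
rewrite -tnth_nth tnth_mktuple insubN ?ltnn // mulr0 addr0.
exact: set_last0_mwiden.
Qed.

Lemma meval1_mesym (k : nat) : (mesym n F k).@[fun=> 1] = 'C(n, k)%:R.
Proof.
rewrite mesymE raddf_sum /= (eq_bigr (fun=> 1)) => [|h _].
  by rewrite sumr_const -cardsE card_draws card_ord.
by rewrite mevalX big1 // => i _; rewrite expr1n.
Qed.

Lemma meval_sym (p : {mpoly F[n]}) (s : 'S_n) (v : 'I_n -> F) :
  p \is mpoly.symmetric -> p.@[v \o s] = p.@[v].
Proof.
(* With [p] replaced by [msym s p] on the right, the identity holds for every polynomial, so
   induction on [p] applies. *)
move=> /issymP /(_ s) {2}<-; elim/mpolyind: p => [|c m p _ _ IHp].
  by rewrite !raddf0.
rewrite msymD msymZ !mevalD !mevalZ IHp msymX !mevalX.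
congr (_ * _ + _); rewrite [RHS](reindex_inj (@perm_inj _ s)) /=.
by apply: eq_bigr => i _; rewrite mnmE permK.
Qed.

End MesymRestriction.

Section Eigenvalue.
Context (n : nat) (F : numFieldType).

(* Symmetry moves the argument 0 from the first slot to the last one. *)
Lemma meval_set_last0 (p : {mpoly F[n.+1]}) : p \is mpoly.symmetric ->
  (set_last0 p).@[fun=> 1] =
  p.@[fun i : 'I_n.+1 => if val i == 0%N then 0 else 1].
Proof.
move=> /(@meval_sym _ _ _ (tperm ord0 ord_max)) <-.
rewrite comp_mpoly_meval; apply: meval_eq => i; rewrite tnth_mktuple.
rewrite /comp -[val (tperm _ _ i) == _]/(tperm _ _ i == ord0).
rewrite -(inj_eq (@perm_inj _ (tperm ord0 ord_max))) tpermK tpermL.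
have [j|] := unliftP ord_max i => ->.
  by rewrite eq_sym (negbTE (neq_lift _ _)) [val _]lift_max valK mevalXU.
by rewrite eqxx insubN ?ltnn // meval0.
Qed.

(** The restriction is C(n,k)/C(n+1,k) times [ebar n F k]; evaluating it at all ones identifies this
    ratio with the displayed scalar. For k > n both sides vanish. *)
Lemma set_last0_ebar (k : nat) :
  set_last0 (ebar n.+1 F k) =
  (ebar n.+1 F k).@[fun i : 'I_n.+1 => if val i == 0%N then 0 else 1]
    *: ebar n F k.
Proof.
rewrite -meval_set_last0 ?rpredZ ?mesym_sym // /ebar /set_last0 comp_mpolyZ.
rewrite -/(set_last0 _) set_last0_mesym mevalZ meval1_mesym scalerA.
have [lekn|ltnk] := leqP k n; first by rewrite mulfK // bin_natr_neq0.
by rewrite mesym_geqnE // !scaler0.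
Qed.

Lemma meval_ebar_neq0 (k : nat) : (k <= n)%N ->
  (ebar n.+1 F k).@[fun i : 'I_n.+1 => if val i == 0%N then 0 else 1] != 0.
Proof.
move=> lekn; rewrite -meval_set_last0 ?rpredZ ?mesym_sym // /ebar /set_last0.
rewrite comp_mpolyZ -/(set_last0 _) set_last0_mesym mevalZ meval1_mesym.
by rewrite mulf_neq0 ?invr_neq0 // bin_natr_neq0 // leqW.
Qed.

Lemma ebar_oversize (k : nat) : (n < k)%N -> ebar n F k = 0.
Proof. by move=> ltnk; rewrite /ebar mesym_geqnE // scaler0. Qed.

Lemma qeigE (l : seq nat) (z : F) : qeig n l z =
  \prod_(j < n) (ebar n F j.+1).@[fun i : 'I_n => if val i == 0%N then z else 1]
     ^+ (nth 0 l j - nth 0 l j.+1)%N.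
Proof.
by rewrite /qeig rmorph_prod; apply: eq_bigr => j _; rewrite rmorphXn.
Qed.

End Eigenvalue.

Section RestrictionEbar.
Context (n : nat) (F : numFieldType).

(** The factor ebar_(n+1)(0, 1, ..., 1) = 0 occurs with exponent [nth 0 l n], which is positive. *)
Lemma qeig0_eq0 (l : seq nat) :
  size l = n.+1 -> nth 0%N l n != 0%N -> qeig n.+1 l (0 : F) = 0.
Proof.
move=> szl ln_neq0; rewrite qeigE big_ord_recr /=.
rewrite -meval_set_last0 ?rpredZ ?mesym_sym // set_last0_ebar.
rewrite (@ebar_oversize n) // scaler0 meval0 expr0n.
rewrite [nth _ _ n.+1]nth_default ?szl // subn0.
by rewrite (negbTE ln_neq0) mulr0.
Qed.

Lemma restr0_Ebar (l : seq nat) : size l = n.+1 ->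
  restr0 (Ebar n.+1 F l) = qeig n.+1 l 0 *: Ebar n F (take n l).
Proof.
move=> szl; apply: val_inj => /=.
rewrite /set_last0 /Ebar_poly rmorph_prod big_ord_recr /= rmorphXn /=.
rewrite -/(set_last0 _) set_last0_ebar (@ebar_oversize n) // scaler0.
rewrite [nth _ _ n.+1]nth_default ?szl // subn0 expr0n.
have [ln0|ln_neq0] := eqVneq (nth 0%N l n) 0%N; last first.
  by rewrite qeig0_eq0 // mulr0 scale0r.
rewrite qeigE big_ord_recr /= ln0 sub0n expr0 !mulr1 -scaler_prod.
apply: eq_bigr => i _.
rewrite rmorphXn /= -/(set_last0 _) set_last0_ebar exprZn nth_take //.
(* At i + 1 = n the truncated list returns the default 0, which agrees with the entry of [l] there
   by [ln0]. *)
have [lti|leni] := ltnP i.+1 n; first by rewrite nth_take.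
have -> : i.+1 = n by apply/eqP; rewrite eqn_leq leni ltn_ord.
by rewrite ln0 [nth _ (take _ _) _]nth_default // size_take szl ltnSn.
Qed.

(** The one vanishing scalar, ebar_(n+1)(0, 1, ..., 1), gets exponent 0 from the appended part. *)
Lemma qeig_rcons0_neq0 (l : seq nat) : size l = n ->
  qeig n.+1 (rcons l 0%N) (0 : F) != 0.
Proof.
move=> szl; rewrite qeigE; apply/prodf_neq0 => j _.
have [ltjn|lenj] := ltnP j n; first by rewrite expf_neq0 // meval_ebar_neq0.
rewrite nth_rcons szl ltnNge lenj /= if_same sub0n expr0.
exact: oner_neq0.
Qed.

Lemma is_partition_rcons0 (l : seq nat) :
  is_partition n l -> is_partition n.+1 (rcons l 0%N).
Proof.
case/andP=> /eqP szl srt; rewrite /is_partition size_rcons szl eqxx /=.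
by case: l {szl} srt => //= x s srt; rewrite rcons_path srt /geq /= leq0n.
Qed.

Lemma is_partition_take (l : seq nat) :
  is_partition n.+1 l -> is_partition n (take n l).
Proof.
case/andP=> /eqP szl srt; rewrite /is_partition size_take szl ltnSn eqxx.
exact: take_sorted.
Qed.

(** The e_j in n variables are free generators, so [symf] followed by substitution defines the
    algebra morphism sending each ebar_j in n variables to ebar_j in n + 1 variables. *)
Lemma extend_Ebar_exists :
  exists T : {linear sympoly n F -> sympoly n.+1 F},
    forall l, is_partition n l -> T (Ebar n F l) = Ebar n.+1 F (rcons l 0%N).
Proof.
pose S := [tuple 'C(n, i.+1)%:R *: ebar n.+1 F i.+1 | i < n].
have Ss (f : sympoly n F) : symf f \mPo S \is mpoly.symmetric.
  apply: mcomp_sym => i; rewrite -tnth_nth tnth_mktuple.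
  exact/rpredZ/rpredZ/mesym_sym.
pose t f := SymPoly (Ss f).
have tlin : linear t.
  move=> a f g; apply: val_inj => /=.
  rewrite -comp_mpolyZ -comp_mpolyD; congr (_ \mPo S).
  (* Linearity of [symf] comes from uniqueness of the expression in the e_j. *)
  apply: msym_fundamental_un.
  rewrite comp_mpolyD comp_mpolyZ -!symfP ?(valP f) ?(valP g) //.
  exact: (valP (a *: f + g)).
pose HL := GRing.isLinear.Build F (sympoly n F) (sympoly n.+1 F) *:%R t tlin.
pose T : {linear sympoly n F -> sympoly n.+1 F} := HB.pack t HL.
exists T => l /andP[/eqP szl _]; apply: val_inj => /=.
pose e (j : nat) := (nth 0 l j - nth 0 l j.+1)%N.
have -> : symf (Ebar_poly n F l) =
    \prod_(j < n) (('C(n, j.+1)%:R)^-1 *: 'X_j) ^+ e j.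
  apply: msym_fundamental_un; rewrite -symfP ?Ebar_sym // rmorph_prod.
  apply: eq_bigr => j _; rewrite rmorphXn /= comp_mpolyZ comp_mpolyXU.
  by rewrite -tnth_nth tnth_mktuple.
rewrite rmorph_prod /= /Ebar_poly big_ord_recr /=.
rewrite [nth _ _ n]nth_rcons szl ltnn eqxx sub0n expr0 mulr1.
apply: eq_bigr => j _; rewrite rmorphXn /= comp_mpolyZ comp_mpolyXU.
have binj : 'C(n, j.+1)%:R != 0 :> F by apply: bin_natr_neq0.
rewrite -tnth_nth tnth_mktuple scalerA (mulVf binj) scale1r /e.
by rewrite !nth_rcons_default.
Qed.

End RestrictionEbar.

Theorem proposition3p1 (R : realType) (n : nat) (hn : (2 <= n)%N)
  (Q : R[i] -> {linear sympoly n R[i] -> sympoly n R[i]})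
  (hQ : forall (z : R[i]) (l : seq nat), is_partition n l ->
     Q z (Ebar n R[i] l) = qeig n l z *: Ebar n R[i] l) :
  exists Q0' : {linear sympoly n.-1 R[i] -> sympoly n R[i]},
    [/\ forall f : sympoly n R[i], Q 0 f = Q0' (restr0 f),
        forall Q0'' : {linear sympoly n.-1 R[i] -> sympoly n R[i]},
          (forall f : sympoly n R[i], Q 0 f = Q0'' (restr0 f)) ->
          forall g : sympoly n.-1 R[i], Q0'' g = Q0' g
      & forall l : seq nat, is_partition n.-1 l ->
          Q0' (Ebar n.-1 R[i] l) = Ebar n R[i] (rcons l 0%N)].
Proof.
case: n hn Q hQ => // n _ Q hQ.
have [T hT] := extend_Ebar_exists n R[i].
exists T; split=> [|Q'' hQ''|]; last exact: hT.
- apply: (eq_linear_Ebar _ _ _ (Q 0) (T \o @restr0 n.+1 R[i])) => l pl /=.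
  have /andP[/eqP szl _] := pl.
  rewrite hQ // restr0_Ebar // linearZ_LR hT ?is_partition_take //.
  (* If the last part is 0, dropping it and appending 0 gives back [l]; otherwise the eigenvalue is
     0. *)
  have [ln0|ln_neq0] := eqVneq (nth 0%N l n) 0%N.
    by rewrite -ln0 -take_nth ?szl // -szl take_size.
  by rewrite qeig0_eq0 // !scale0r.
- apply: eq_linear_Ebar => l pl; have pl0 := is_partition_rcons0 _ _ pl.
  have /andP[/eqP szl _] := pl; have /andP[/eqP szl0 _] := pl0.
  (* Scaled by this nonzero eigenvalue, [Ebar] of [l] is the restriction of [Ebar] of [rcons l 0],
     where [Q 0] forces the value of [Q'']. *)
  apply: (scalerI (qeig_rcons0_neq0 _ _ _ szl)).
  rewrite hT // -hQ // hQ'' restr0_Ebar // linearZ_LR.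
  by rewrite -cats1 take_size_cat.
Qed.
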